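(* Let $n \geq 3$ be an integer and let $A_1A_2\cdots A_n$ be an $n$-gon (a polygon with $n$ sides). Suppose a line $d$ intersects the sides $A_iA_{i+1}$ of the $n$-gon in the points $M_i$, for $i \in \{1,\dots,n\}$ (where $A_nA_{n+1}$ means $A_nA_1$), and, when $n \geq 4$, intersects its diagonal $A_2A_n$ in a point $M$. Then $$\prod_{i=1}^{n} \frac{M_i A_i}{M_i A_{i+1}} = 1.$$
   Context: In the displayed formula, $M_iA_i$ denotes the (positive) length of the line segment, i.e. the distance, between $M_i$ and $A_i$, and similarly for all other segments. The index convention is $A_{n+1} = A_1$. *)

(* Defs.v *)
From mathcomp Require Import all_boot all_order all_algebra.
From mathcomp Require Import all_classical all_reals.

Set Implicit Arguments.
Unset Strict Implicit.
Unset Printing Implicit Defensive.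

Import Order.TTheory GRing.Theory Num.Theory.

Local Open Scope classical_set_scope.
Local Open Scope ring_scope.

(* The Euclidean distance. It is defined here because the norm that            *)
(* MathComp-Analysis puts on matrices is the sup norm.                         *)
Definition edist (R : realType) (P Q : 'rV[R]_2) : R :=
  Num.sqrt (\sum_(k < 2) (P 0 k - Q 0 k) ^+ 2).

(* The whole (infinite) line through P and Q; it is the singleton [set P]      *)
(* when P = Q.                                                                 *)
Definition line_through (R : realType) (P Q : 'rV[R]_2) : set 'rV[R]_2 :=
  [set X | exists t : R, X = (1 - t) *: P + t *: Q].

Definition is_line (R : realType) (d : set 'rV[R]_2) : Prop :=
  exists P Q : 'rV[R]_2, P != Q /\ d = line_through P Q.

Definition collinear3 (R : realType) (P Q S : 'rV[R]_2) : Prop :=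
  exists d : set 'rV[R]_2, is_line d /\ [/\ d P, d Q & d S].

(* An n-gon (for n >= 3), as a cyclically ordered family of vertices of the    *)
(* plane no three successive of which are collinear. Neither convexity nor     *)
(* simplicity is required. The successor ordS is cyclic: it sends the last     *)
(* index to the first one.                                                     *)
Definition is_polygon (R : realType) (n : nat) (A : 'I_n -> 'rV[R]_2) : Prop :=
  forall i : 'I_n, ~ collinear3 (A i) (A (ordS i)) (A (ordS (ordS i))).

(* Main.v *)
Require Import Defs.
From mathcomp Require Import all_boot all_order all_algebra.
From mathcomp Require Import all_classical all_reals.
From mathcomp Require Import ring lra.

Import Order.TTheory GRing.Theory Num.Theory.

Local Open Scope classical_set_scope.
Local Open Scope ring_scope.

(** An affine form [f] vanishing exactly on [d] is, up to a common factor, the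
    signed distance to [d].  If [M] on the line [PQ] lies on [d], similar
    triangles give [MP / MQ = |f P| / |f Q|], so the product telescopes around
    the polygon. *)

Lemma rV2_eqP (R : realType) (X Y : 'rV[R]_2) :
  X = Y <-> X 0 0 = Y 0 0 /\ X 0 1 = Y 0 1.
Proof.
split=> [-> //|[e0 e1]]; apply/rowP=> k.
by case: k => [[|[|//]] lt_k];
  [move: e0|move: e1]; congr (X _ _ = Y _ _); apply: val_inj.
Qed.

(** The coefficients [(v, - u)] are normal to the direction [(u, v)] of the line, and the constant
    makes the form vanish at [P]. *)
Lemma line_equation (R : realType) (d : set 'rV[R]_2) : is_line d ->
  exists a b c : R, forall X : 'rV[R]_2, d X <-> a * X 0 0 + b * X 0 1 + c = 0.
Proof.
move=> [P [Q [neq_PQ ->]]].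
set u := Q 0 0 - P 0 0; set v := Q 0 1 - P 0 1.
have uv_neq0 : u ^+ 2 + v ^+ 2 != 0.
  apply: contra_neq neq_PQ => /eqP.
  rewrite paddr_eq0 ?sqr_ge0 // !sqrf_eq0 !subr_eq0 => /andP[/eqP e0 /eqP e1].
  by apply/rV2_eqP.
exists v, (- u), (u * P 0 1 - v * P 0 0) => X; split=> [[t ->]|eX].
  by rewrite !mxE /u /v; ring.
(* This parameter gives the orthogonal projection of [X] on the line; in each coordinate the error
   is a multiple of the form at [X], hence zero. *)
exists (((X 0 0 - P 0 0) * u + (X 0 1 - P 0 1) * v) / (u ^+ 2 + v ^+ 2)).
have eQ0 : Q 0 0 = P 0 0 + u by rewrite /u; ring.
have eQ1 : Q 0 1 = P 0 1 + v by rewrite /v; ring.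
apply/rV2_eqP; rewrite !mxE eQ0 eQ1; split; apply/eqP; rewrite -subr_eq0.
- rewrite (_ : _ - _ = v * (v * X 0 0 + - u * X 0 1 + (u * P 0 1 - v * P 0 0))
                       / (u ^+ 2 + v ^+ 2)); last by field.
  by rewrite eX mulr0 mul0r.
- rewrite (_ : _ - _ = - u * (v * X 0 0 + - u * X 0 1 + (u * P 0 1 - v * P 0 0))
                       / (u ^+ 2 + v ^+ 2)); last by field.
  by rewrite eX mulr0 mul0r.
Qed.

Lemma edistC (R : realType) (P Q : 'rV[R]_2) : edist P Q = edist Q P.
Proof.
by congr Num.sqrt; apply: eq_bigr => k _; rewrite -opprB sqrrN.
Qed.

Lemma edist_eq0 (R : realType) (P Q : 'rV[R]_2) : edist P Q = 0 -> P = Q.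
Proof.
move/eqP; rewrite sqrtr_eq0 => le0; apply/rowP=> k; apply/eqP.
rewrite -subr_eq0 -sqrf_eq0.
have : \sum_(k < 2) (P 0 k - Q 0 k) ^+ 2 == 0.
  by rewrite eq_le le0 sumr_ge0 // => j _; rewrite sqr_ge0.
rewrite psumr_eq0 => [/allP/(_ k)|j _]; last by rewrite sqr_ge0.
by rewrite mem_index_enum => /(_ isT).
Qed.

Lemma edist_line_l (R : realType) (P Q : 'rV[R]_2) (t : R) :
  edist ((1 - t) *: P + t *: Q) P = `|t| * edist P Q.
Proof.
rewrite /edist -sqrtr_sqr -sqrtrM ?sqr_ge0 // mulr_sumr; congr Num.sqrt.
by apply: eq_bigr => k _; rewrite !mxE; ring.
Qed.

Lemma edist_line_r (R : realType) (P Q : 'rV[R]_2) (t : R) :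
  edist ((1 - t) *: P + t *: Q) Q = `|1 - t| * edist P Q.
Proof.
by rewrite [edist P Q]edistC -edist_line_l subKr addrC.
Qed.

(** At parameter [t] the two distances are [|t|] and [|1 - t|] times [edist P Q], while [f], being
    affine, satisfies [(1 - t) * f P + t * f Q = f X = 0]. *)
Lemma edist_ratio (R : realType) (a b c : R) (P Q X : 'rV[R]_2) :
  let f (Y : 'rV[R]_2) := a * Y 0 0 + b * Y 0 1 + c in
  line_through P Q X -> f X = 0 -> f Q != 0 -> X != P -> X != Q ->
  edist X P / edist X Q = `|f P| / `|f Q|.
Proof.
move=> f [t ->] fX fQ neq_P neq_Q.
have PQ0 : edist P Q != 0.
  apply: contra_neq neq_P => /edist_eq0 <-.
  by rewrite -scalerDl subrK scale1r.
have t1 : 1 - t != 0.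
  apply: contra_neq neq_Q => t1; rewrite t1.
  have -> : t = 1 by lra.
  by rewrite scale0r add0r scale1r.
rewrite edist_line_l edist_line_r -mulf_div divff // mulr1.
apply/eqP; rewrite eqr_div ?normr_eq0 // -!normrM -normrN; apply/eqP.
(* After the sign change the two cross products differ by exactly [f X]. *)
congr (`| _ |); apply/eqP; rewrite eq_sym -subr_eq0 -fX /f !mxE; apply/eqP; ring.
Qed.

(** The cyclic successor permutes the indices, so numerators and denominators have the same
    product. *)
Lemma prod_ordS_telescope (F : fieldType) (n : nat) (g : 'I_n -> F) :
  (forall i, g i != 0) -> \prod_(i < n) (g i / g (ordS i)) = 1.
Proof.
move=> g0; rewrite prodf_div [X in X / _](reindex_inj (@ordS_inj n)) /= divff //.
by apply/prodf_neq0.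
Qed.

(* Indices start at 0: the vertices A_1, ..., A_n are A 0, ..., A (n - 1), so  *)
(* that the diagonal A_2 A_n joins the vertices of index 1 and n - 1.          *)
Theorem mainTheorem4 (R : realType) (n : nat) (hn : (3 <= n)%N)
  (A : 'I_n -> 'rV[R]_2) (hA : is_polygon A)
  (d : set 'rV[R]_2) (hd : is_line d)
  (M : 'I_n -> 'rV[R]_2)
  (hM : forall i : 'I_n, d `&` line_through (A i) (A (ordS i)) = [set M i])
  (hMA : forall i : 'I_n, M i != A i /\ M i != A (ordS i))
  (M0 : 'rV[R]_2)
  (hM0 : (4 <= n)%N -> forall i j : 'I_n, i = 1%N :> nat -> j = n.-1 :> nat ->
     d `&` line_through (A i) (A j) = [set M0]) :
  \prod_(i < n) (edist (M i) (A i) / edist (M i) (A (ordS i))) = 1.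
Proof.
have [a [b [c dE]]] := line_equation _ _ hd.
pose f (Y : 'rV[R]_2) := a * Y 0 0 + b * Y 0 1 + c.
have MP i : d (M i) /\ line_through (A i) (A (ordS i)) (M i).
  by have : [set M i] (M i) by []; rewrite -hM.
(* A vertex on [d] would be the only common point [M i] of [d] and its side line, against [hMA]. *)
have fA i : f (A i) != 0.
  apply/eqP=> /dE dA; have [/eqP + _] := hMA i; apply.
  suff : [set M i] (A i) by move=> ->.
  by rewrite -hM; split=> //; exists 0; rewrite subr0 scale1r scale0r addr0.
(* Writing 1 as a telescoping product reduces the claim to an equality of factors. *)
rewrite -[RHS](@prod_ordS_telescope _ n (fun i => `|f (A i)|)); last first.
  by move=> i; rewrite normr_eq0.
apply: eq_bigr => i _; have [dM lM] := MP i; have [neqA neqS] := hMA i.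
by apply: edist_ratio => //; [apply/dE|apply: fA].
Qed.
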